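(* Let $\Omega_1\subset\Omega_2\subset\mathbb{C}\equiv\mathbb{R}^2$ be such that $\Omega:=\Omega_2\setminus\overline{\Omega}_1$ is a doubly connected domain, let $0<\rho<R$, and let $F:\Omega\to B_R\setminus\overline{B_\rho}=\{z\in\mathbb{C}:\rho<|z|<R\}$ be analytic and univalent, mapping $\Omega$ onto $B_R\setminus\overline{B_\rho}$. Define, for $\mathbf{x}=(x_1,x_2)\in\Omega$ identified with $z=x_1+ix_2$, $$\mathfrak{F}(\mathbf{x})=-\frac{|F'(z)|^2}{|F(z)|^2}+|F'(z)|^2\left\{\frac{1}{|F(z)|-\rho}+\frac{1}{R-|F(z)|}\right\}^2 .$$ Then for all $u\in C_0^\infty(\Omega)$, $$\int_\Omega|\nabla u(\mathbf{x})|^2\,d\mathbf{x}\ \ge\ \frac14\int_\Omega\mathfrak{F}(\mathbf{x})\,|u(\mathbf{x})|^2\,d\mathbf{x}.$$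
   Context: $B_r$ is the open disc of radius $r$ centred at the origin in $\mathbb{C}\equiv\mathbb{R}^2$. A domain in $\mathbb{R}^2\equiv\mathbb{C}$ is doubly connected if its boundary is a disjoint union of two simple curves. ''Univalent'' means injective, and $F'$ is the complex derivative. *)

(* Defs.v *)
From HB Require Import structures.
From mathcomp Require Import all_boot all_order all_algebra.
From mathcomp Require Import complex.
From mathcomp Require Import all_classical all_reals all_analysis.

Set Implicit Arguments.
Unset Strict Implicit.
Unset Printing Implicit Defensive.

Import Order.TTheory GRing.Theory Num.Theory.
Import numFieldNormedType.Exports.

Local Open Scope ring_scope.
Local Open Scope complex_scope.
Local Open Scope classical_set_scope.

(* The plane is [R * R], which carries the topology, the real differential
   calculus and the Lebesgue measure; [R[i]] carries the complex calculus. *)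
Definition toC (R : realType) (x : R * R) : R[i] := x.1 +i* x.2.

(* The modulus as an element of [R] (the library's [`|z|] lives in [R[i]]). *)
Definition modulus (R : realType) (z : R[i]) : R :=
  Normc.normc z.

Definition annulus (R : realType) (r1 r2 : R) : set R[i] :=
  [set z | r1 < modulus z < r2].

Definition boundary (T : topologicalType) (A : set T) : set T :=
  closure A `\` interior A.

(* A non-closed simple curve is parametrised by any non-degenerate interval,
   so that, besides Jordan arcs, unbounded curves such as lines and rays are
   covered; the properness clause (automatic when [J] is compact) excludes
   curves that accumulate on themselves, such as the figure 6. *)
Definition simple_arc (R : realType) (G : set (R * R)) : Prop :=
  exists (J : set R) (g : R -> R * R),
    [/\ is_interval J /\ (exists s t, [/\ J s, J t & s < t]),
        {within J, continuous g},
        set_inj J g,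
        (forall K, compact K -> compact (J `&` g @^-1` K)) &
        g @` J = G].

Definition simple_closed_curve (R : realType) (G : set (R * R)) : Prop :=
  exists g : R -> R * R,
    [/\ {within `[0, 1], continuous g},
        g 0 = g 1,
        set_inj `[0, 1[ g &
        g @` `[0, 1] = G].

Definition simple_curve (R : realType) (G : set (R * R)) : Prop :=
  simple_arc G \/ simple_closed_curve G.

Definition domain (T : topologicalType) (A : set T) : Prop :=
  [/\ A !=set0, open A & connected A].

Definition doubly_connected (R : realType) (Om : set (R * R)) : Prop :=
  exists G1 G2 : set (R * R),
    [/\ simple_curve G1, simple_curve G2,
        G1 `&` G2 = set0 & boundary Om = G1 `|` G2].

(* Local representation by convergent power series. The regular module
   [R[i]^o] provides the topology of [R[i]]. *)
Definition analytic_on (R : realType) (D : set R[i]) (F : R[i] -> R[i]) :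
    Prop :=
  forall z0, D z0 -> exists (a : nat -> R[i]) (r : R), 0 < r /\
    forall z, modulus (z - z0) < r ->
      series (fun n => a n * (z - z0) ^+ n : R[i]^o) n @[n --> \oo]
        --> (F z : R[i]^o).

Definition cderiv (R : realType) (F : R[i] -> R[i]) (z : R[i]) : R[i] :=
  derive1 (F : R[i]^o -> R[i]^o) z.

Definition d1 (R : realType) (f : R * R -> R) : R * R -> R :=
  'D_((1, 0) : R * R) f.
Definition d2 (R : realType) (f : R * R -> R) : R * R -> R :=
  'D_((0, 1) : R * R) f.

Fixpoint Ck (R : realType) (n : nat) (f : R * R -> R) : Prop :=
  if n is m.+1 then
    [/\ forall x, differentiable f x, Ck m (d1 f) & Ck m (d2 f)]
  else continuous f.

(* [C_0^oo(Om)], complex-valued; functions on [Om] are identified with their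
   extension by 0 to the plane. *)
Definition test_function (R : realType) (Om : set (R * R))
    (u : R * R -> R[i]) : Prop :=
  [/\ forall n, Ck n (fun x => complex.Re (u x)),
      forall n, Ck n (fun x => complex.Im (u x)),
      compact (closure [set x | u x != 0]) &
      closure [set x | u x != 0] `<=` Om].

Definition grad_sq (R : realType) (u : R * R -> R[i]) (x : R * R) : R :=
  let ur := fun y => complex.Re (u y) in
  let ui := fun y => complex.Im (u y) in
  modulus (d1 ur x +i* d1 ui x) ^+ 2 + modulus (d2 ur x +i* d2 ui x) ^+ 2.

Definition hardy_weight (R : realType) (rho rad : R) (F : R[i] -> R[i])
    (x : R * R) : R :=
  let z := toC x in
  - (modulus (cderiv F z) ^+ 2 / modulus (F z) ^+ 2)
  + modulus (cderiv F z) ^+ 2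
    * ((modulus (F z) - rho)^-1 + (rad - modulus (F z))^-1) ^+ 2.

Definition lebesgue2 (R : realType) :=
  ((@lebesgue_measure R) \x (@lebesgue_measure R))%E.

(* Main.v *)
(* Put a = 1 / (|F| - rho) and b = 1 / (rad - |F|). The positive function
   phi = |F|^(-1/2) ((|F| - rho) (rad - |F|))^(1/2) satisfies
   - Delta phi = (W / 4) phi with W the Hardy weight: since F is conformal this
   is an ODE in r = |F|, which for g = r^(1/2) phi reads
   - g'' = (a + b)^2 g / 4. Hence V = - grad (log phi) satisfies
   div V - |V|^2 = W / 4, and integrating |grad u + u V|^2 >= 0 by parts gives
   the inequality. *)

Require Import Defs.
From HB Require Import structures.
From mathcomp Require Import all_boot all_order all_algebra.
From mathcomp Require Import complex.
From mathcomp Require Import all_classical all_reals all_analysis.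
From mathcomp Require Import measurable_realfun.
From mathcomp Require Import ring lra.

Set Implicit Arguments.
Unset Strict Implicit.
Unset Printing Implicit Defensive.

Import Order.TTheory GRing.Theory Num.Theory.
Import numFieldNormedType.Exports.

Local Open Scope ring_scope.
Local Open Scope complex_scope.
Local Open Scope classical_set_scope.

(** Why this [phi]: [g = ((r - rho)(rad - r))^(1/2)] has [g'/g = (a - b)/2], and [a' = - a^2],
    [b' = b^2] turn this into [g''/g = - (a + b)^2 / 4]; it is the positive solution behind the
    one-dimensional Hardy inequality on an interval. The factor [r^(-1/2)] removes the first-order
    term of the radial Laplacian and leaves the potential [- 1/(4 r^2)], the source of the negative
    term of the weight. Only the field [V] occurs below, never [phi] itself. The obstacle is
    regularity. The derivatives of [V] involve [F''], which must moreover be continuous, while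
    analyticity only says that [F] is locally the sum of a power series; everything is extracted
    from the series through a first-order expansion with quadratic remainder. Since [V] is
    controlled on [Om] only, the integration by parts is applied to [|u|^2 V], which vanishes off a
    compact subset of [Om] and has continuous partial derivatives on the whole plane. *)

(** * Integrals over the plane of continuous, compactly supported derivatives *)

(** Measurability refers to the product sigma-algebra, so [U] is written as the countable union of
    the boxes with rational centre and radius that fit into it. *)
Lemma open_measurable_prod (R : realType) (U : set (R * R)) :
  open U -> measurable (U : set (measurableTypeR R * measurableTypeR R)).
Proof.
move=> oU.
pose box (q : rat * rat * rat) : set (R * R) :=
  ball (ratr q.1.1 : R) (ratr q.2) `*` ball (ratr q.1.2 : R) (ratr q.2).
pose G (q : rat * rat * rat) := [set x | box q x /\ box q `<=` U].
have mG q : measurable (G q : set (measurableTypeR R * measurableTypeR R)).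
  have [qU|qU] := pselect (box q `<=` U).
    rewrite (_ : G q = box q); last by apply/seteqP; split=> x; [case | split].
    by apply: measurableX; apply: open_measurable; exact: ball_open.
  by rewrite (_ : G q = set0)//; apply/seteqP; split=> x // [].
rewrite (_ : U = \bigcup_a \bigcup_b \bigcup_r G (a, b, r)); last first.
  apply/seteqP; split=> [x Ux|x [a _ [b _ [r _ []]]]]; last by move=> bx; apply.
  have /nbhs_ballP[e /= e0 xeU] : nbhs x U by exact: open_nbhs_nbhs.
  (* Half of [e], because a point of the box is within [ratr r] of a centre that is itself within
     [ratr r] of [x]. *)
  have [r] : exists q : rat, ratr q \in `]0, (e / 2)[%R.
    by apply: rat_in_itvoo; rewrite divr_gt0.
  rewrite in_itv/= => /andP[r0 re].
  have [a] : exists q : rat, ratr q \in `](x.1 - ratr r), (x.1 + ratr r)[%R.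
    by apply: rat_in_itvoo; lra.
  rewrite in_itv/= => /andP[a1 a2].
  have [b] : exists q : rat, ratr q \in `](x.2 - ratr r), (x.2 + ratr r)[%R.
    by apply: rat_in_itvoo; lra.
  rewrite in_itv/= => /andP[b1 b2].
  exists a => //; exists b => //; exists r => //; split.
    by split; rewrite /ball/= ltr_norml; lra.
  move=> y [/=]; rewrite /ball/= !ltr_norml => /andP[y1 y2] /andP[y3 y4].
  by apply: xeU; split; rewrite /ball/= ltr_norml; lra.
by do 3 (apply: bigcupT_measurable_rat => ?).
Qed.

Lemma continuous_measurable_prod (R : realType) (f : R * R -> R) :
  continuous f ->
  measurable_fun setT (f : measurableTypeR R * measurableTypeR R -> R).
Proof.
move=> /continuousP cf.
apply: (measurability _ (RGenOpens.measurableE R)) => _ [_ [a [b ->] <-]].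
rewrite setTI; apply: open_measurable_prod; apply: cf; exact: interval_open.
Qed.

Lemma compact_prod_bounded (R : realType) (K : set (R * R)) : compact K ->
  exists2 M : R, 0 < M & forall x, K x -> `|x.1| < M /\ `|x.2| < M.
Proof.
move=> /compact_bounded[M [Mr KM]]; exists (`|M| + 1).
  by have := normr_ge0 M; lra.
move=> x /(KM (`|M| + 2^-1) _)/=.
have M0 : M < `|M| + 2^-1 by have := ler_norm M; lra.
by move=> /(_ M0); rewrite prod_normE ge_max/= => /andP[? ?]; split; lra.
Qed.

(** Off a square [f] vanishes; on the square, which is compact and of finite measure, it is
    bounded. *)
Lemma continuous_integrable_prod (R : realType) (f : R * R -> R)
    (K : set (R * R)) :
  compact K -> continuous f -> (forall x, ~ K x -> f x = 0) ->
  (@lebesgue2 R).-integrable setT (EFin \o f).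
Proof.
move=> cK cf f0.
have [M M0 KM] := compact_prod_bounded cK.
pose I : set R := `[- M, M].
pose B : set (R * R) := I `*` I.
have mB : measurable (B : set (measurableTypeR R * measurableTypeR R)).
  by apply: measurableX; exact: measurable_itv.
have KB : K `<=` B.
  move=> x /KM[/ltW + /ltW].
  by rewrite !ler_norml => x1 x2; split; rewrite /I/= in_itv.
have -> : EFin \o f = (EFin \o f) \_ B.
  apply/funext => x; rewrite patchE; case: ifPn => //= /negP xB.
  by rewrite f0// => /KB/mem_set.
apply/(integrable_mkcond _ mB).
apply: measurable_bounded_integrable => //.
- suff : (@lebesgue2 R B < +oo)%E by [].
  have -> : (@lebesgue2 R B = lebesgue_measure I * lebesgue_measure I)%E.
    by apply: product_measure1E; exact: measurable_itv.
  by rewrite !lebesgue_measure_itv/=; case: ifP => _; rewrite -?EFinD -?EFinM ?mul0e ltry.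
- apply: measurable_funTS; exact: continuous_measurable_prod.
- have cB : compact B by apply: compact_setX; exact: segment_compact.
  have cfB : {within B, continuous f} by exact: continuous_subspaceT.
  have [N [Nr fN]] := compact_bounded (continuous_compact cfB cB).
  exists N; split=> // m /fN Nm x Bx /=.
  by apply: Nm; exists x.
Qed.

(** Both endpoints fall under the vanishing hypothesis, so the fundamental theorem of calculus on
    [[a, b]] gives [g b - g a = 0]. *)
Lemma integral_slice_derive (R : realType) (g dg : R -> R) (a b : R) :
  a < b -> (forall x, x <= a \/ b <= x -> g x = 0) ->
  (forall x, x <= a \/ b <= x -> dg x = 0) ->
  (forall x : R, is_derive x 1 g (dg x)) -> continuous dg ->
  (\int[@lebesgue_measure R]_x (dg x)%:E)%E = 0%E.
Proof.
move=> ab g0 dg0 dgP cdg.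
have cg : continuous g.
  by move=> x; apply: differentiable_continuous; apply/derivable1_diffP; case: (dgP x).
have -> : (fun x => (dg x)%:E) = (fun x => (dg x)%:E) \_ `[a, b].
  apply/funext => x; rewrite patchE; case: ifPn => //= /negP xB.
  rewrite dg0//; apply/orP; apply/negPn; rewrite negb_or -!ltNge.
  apply/negP => /andP[xa xb]; apply: xB; rewrite inE/= in_itv/=.
  by rewrite !ltW.
rewrite -integral_mkcond (@continuous_FTC2 _ dg g)//.
- by rewrite (g0 b (or_intror (lexx b))) (g0 a (or_introl (lexx a))) subee.
- exact: continuous_subspaceT.
- split=> [x _| | ].
  + by case: (dgP x).
  + exact/cvg_at_right_filter/cg.
  + exact/cvg_at_left_filter/cg.
- by move=> x _; rewrite derive1E; case: (dgP x).
Qed.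


Lemma slice_continuous_x (R : realType) (x y : R) :
  {for x, continuous (fun t : R => (t, y))}.
Proof.
exact: (@cvg_pair R _ _ (nbhs x) (nbhs x) (nbhs y) _ _ _ id (cst y)
  cvg_id (cvg_cst _)).
Qed.

Lemma slice_continuous_y (R : realType) (x y : R) :
  {for y, continuous (fun t : R => (x, t))}.
Proof.
exact: (@cvg_pair R _ _ (nbhs y) (nbhs x) (nbhs y) _ _ _ (cst x) id
  (cvg_cst _) cvg_id).
Qed.

(** Fubini with the differentiated variable innermost. The derivative is asked of slices only,
    because [g] will be a product with a field whose derivatives are known along coordinate
    lines. *)
Lemma integral_d1_eq0 (R : realType) (K : set (R * R)) (g dg : R * R -> R) :
  compact K -> (forall x, ~ K x -> g x = 0) -> (forall x, ~ K x -> dg x = 0) ->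
  continuous dg ->
  (forall x y : R, is_derive x 1 (fun t => g (t, y)) (dg (x, y))) ->
  (\int[@lebesgue2 R]_x (dg x)%:E)%E = 0%E.
Proof.
move=> cK g0 dg0 cdg dgP.
have dg_int := continuous_integrable_prod cK cdg dg0.
rewrite /lebesgue2 -(integral21_prod_meas1 dg_int).
have [M M0 KM] := compact_prod_bounded cK.
have offK (x y : R) : x <= - M \/ M <= x -> ~ K (x, y).
  by move=> + /KM[]; rewrite /= !ltr_norml; lra.
have cdgs (y : R) : continuous (fun t : R => dg (t, y)).
  move=> x; apply: (@continuous_comp _ _ _ (fun t : R => (t, y)) dg).
    exact: slice_continuous_x.
  exact: cdg.
apply: integral0_eq => y _; rewrite /fubini_G/=.
apply: (@integral_slice_derive R (fun t => g (t, y)) (fun t => dg (t, y)) (- M) M).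
- by lra.
- by move=> x ?; apply: g0; exact: offK.
- by move=> x ?; apply: dg0; exact: offK.
- exact: cdgs.
Qed.

Lemma integral_d2_eq0 (R : realType) (K : set (R * R)) (g dg : R * R -> R) :
  compact K -> (forall x, ~ K x -> g x = 0) -> (forall x, ~ K x -> dg x = 0) ->
  continuous dg ->
  (forall x y : R, is_derive y 1 (fun t => g (x, t)) (dg (x, y))) ->
  (\int[@lebesgue2 R]_x (dg x)%:E)%E = 0%E.
Proof.
move=> cK g0 dg0 cdg dgP.
have dg_int := continuous_integrable_prod cK cdg dg0.
rewrite /lebesgue2 -(integral12_prod_meas1 dg_int).
have [M M0 KM] := compact_prod_bounded cK.
have offK (x y : R) : y <= - M \/ M <= y -> ~ K (x, y).
  by move=> + /KM[]; rewrite /= !ltr_norml; lra.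
have cdgs (x : R) : continuous (fun t : R => dg (x, t)).
  move=> y; apply: (@continuous_comp _ _ _ (fun t : R => (x, t)) dg).
    exact: slice_continuous_y.
  exact: cdg.
apply: integral0_eq => x _; rewrite /fubini_F/=.
apply: (@integral_slice_derive R (fun t => g (x, t)) (fun t => dg (x, t)) (- M) M).
- by lra.
- by move=> y ?; apply: g0; exact: offK.
- by move=> y ?; apply: dg0; exact: offK.
- exact: cdgs.
Qed.

(** * The modulus, and convergence of complex sequences and series *)

Lemma modulusM (R : realType) (x y : R[i]) :
  modulus (x * y) = modulus x * modulus y.
Proof. exact: Normc.normcM. Qed.

Lemma modulus0 (R : realType) : modulus (0 : R[i]) = 0.
Proof. exact: Normc.normc0. Qed.

Lemma modulus_ge0 (R : realType) (x : R[i]) : 0 <= modulus x.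
Proof. by case: x => a b; exact: sqrtr_ge0. Qed.

Lemma modulusN (R : realType) (x : R[i]) : modulus (- x) = modulus x.
Proof. exact: normcN. Qed.

Lemma ler_modulusD (R : realType) (x y : R[i]) :
  modulus (x + y) <= modulus x + modulus y.
Proof. exact: le_normcD. Qed.

Lemma modulus_real (R : realType) (x : R) : modulus x%:C = `|x|.
Proof. by rewrite /modulus/= expr0n/= addr0 sqrtr_sqr. Qed.

Lemma normCE (R : realType) (x : R[i]) : `|x| = (modulus x)%:C.
Proof. by case: x. Qed.

Lemma modulusX (R : realType) (x : R[i]) n : modulus (x ^+ n) = modulus x ^+ n.
Proof.
elim: n => [|n IHn]; last by rewrite !exprS modulusM IHn.
by rewrite !expr0; exact: Normc.normc1.
Qed.

Lemma modulus_nat (R : realType) n : modulus (n%:R : R[i]) = n%:R.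
Proof.
by rewrite -(rmorph_nat (real_complex R)) modulus_real ger0_norm.
Qed.

Lemma sqr_modulus (R : realType) (x : R[i]) :
  modulus x ^+ 2 = complex.Re x ^+ 2 + complex.Im x ^+ 2.
Proof. by case: x => a b; rewrite /modulus/= sqr_sqrtr// addr_ge0// sqr_ge0. Qed.

Lemma ler_Re_modulus (R : realType) (x : R[i]) : `|complex.Re x| <= modulus x.
Proof.
rewrite -(ler_pXn2r (ltn0Sn 1)) ?nnegrE ?modulus_ge0//.
by rewrite sqr_modulus real_normK ?num_real// lerDl sqr_ge0.
Qed.

Lemma ler_Im_modulus (R : realType) (x : R[i]) : `|complex.Im x| <= modulus x.
Proof.
rewrite -(ler_pXn2r (ltn0Sn 1)) ?nnegrE ?modulus_ge0//.
by rewrite sqr_modulus real_normK ?num_real// lerDr sqr_ge0.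
Qed.

Lemma modulus_le_ReIm (R : realType) (x : R[i]) :
  modulus x <= `|complex.Re x| + `|complex.Im x|.
Proof.
rewrite -(ler_pXn2r (ltn0Sn 1)) ?nnegrE ?modulus_ge0 ?addr_ge0//.
rewrite sqr_modulus -(real_normK (num_real (complex.Re x))).
rewrite -(real_normK (num_real (complex.Im x))).
by have := normr_ge0 (complex.Re x); have := normr_ge0 (complex.Im x); nra.
Qed.

Lemma modulus_cvgP (R : realType) (u : nat -> R[i]) (l : R[i]) :
  (u n : R[i]^o) @[n --> \oo] --> (l : R[i]^o) <->
  forall e : R, 0 < e -> \forall n \near \oo, modulus (l - u n) < e.
Proof.
split=> [/cvgrPdist_lt ul e e0|ul].
  have := ul e%:C; rewrite ltcR => /(_ e0).
  by apply: filterS => n; rewrite normCE ltcR.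
apply/cvgrPdist_lt => -[e e'] e0.
(* Positivity in [R[i]] forces a zero imaginary part, so the tolerance is real. *)
have [e'0 {}e0] : e' = 0 /\ 0 < e.
  by move: e0; rewrite ltcE/= => /andP[/eqP <-].
rewrite e'0; have := ul e e0; apply: filterS => n.
by rewrite normCE; rewrite -[e +i* 0]/(e%:C) ltcR.
Qed.

Lemma modulus_cvg_le (R : realType) (u : nat -> R[i]) (l : R[i]) (B : R) :
  (u n : R[i]^o) @[n --> \oo] --> (l : R[i]^o) ->
  (forall n, modulus (u n) <= B) -> modulus l <= B.
Proof.
move=> /modulus_cvgP ul uB; rewrite leNgt; apply/negP => Bl.
have [] := @filter_ex _ \oo _ _ (ul (modulus l - B) ltac:(by rewrite subr_gt0)).
move=> n; have := uB n; have := ler_modulusD (l - u n) (u n).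
by rewrite subrK; lra.
Qed.

Lemma complex_cvg (R : realType) (u : nat -> R[i]) (a b : R) :
  complex.Re (u n) @[n --> \oo] --> a -> complex.Im (u n) @[n --> \oo] --> b ->
  (u n : R[i]^o) @[n --> \oo] --> (a +i* b : R[i]^o).
Proof.
move=> /cvgrPdist_lt ua /cvgrPdist_lt ub; apply/modulus_cvgP => e e0.
have e20 : 0 < e / 2 by rewrite divr_gt0.
near=> n; apply: le_lt_trans (modulus_le_ReIm _) _.
rewrite [e]splitr ltrD//.
  have -> : complex.Re (a +i* b - u n) = a - complex.Re (u n) by case: (u n).
  by near: n; exact: ua.
have -> : complex.Im (a +i* b - u n) = b - complex.Im (u n) by case: (u n).
by near: n; exact: ub.
Unshelve. all: by end_near. Qed.

(** Comparison test, carried out on the real and imaginary parts, each dominated by the modulus. *)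
Lemma complex_series_cvg (R : realType) (a : nat -> R[i]) (v : nat -> R) :
  (forall n, modulus (a n) <= v n) -> cvgn (series v) ->
  exists l : R[i], series (a : nat -> R[i]^o) n @[n --> \oo] --> (l : R[i]^o).
Proof.
move=> av cv.
have v0 n : 0 <= v n by exact: le_trans (modulus_ge0 _) (av n).
have conv (f : nat -> R) : (forall n, `|f n| <= modulus (a n)) -> cvgn (series f).
  move=> fa; apply: (@normed_cvg R R^o); apply: series_le_cvg cv => // n.
    exact: normr_ge0.
  exact: le_trans (fa n) (av n).
have := conv (fun n => complex.Re (a n)) (fun n => ler_Re_modulus _).
have := conv (fun n => complex.Im (a n)) (fun n => ler_Im_modulus _).
move=> /cvg_ex[/= y ay] /cvg_ex[/= x ax].
exists (x +i* y); apply: complex_cvg.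
  by rewrite /series/=; under eq_fun do rewrite raddf_sum.
by rewrite /series/=; under eq_fun do rewrite raddf_sum.
Qed.

(** * Termwise differentiation of power series *)

(** The left side is one term of the binomial expansion of the right side. This trades the factor
    [n.+1] of a derivative for a slightly larger radius. *)
Lemma natmul_expr_le (R : realFieldType) (t d : R) n :
  0 <= t -> 0 < d -> n.+1%:R * t ^+ n * d <= (t + d) ^+ n.+1.
Proof.
move=> t0 d0; elim: n => [|n IHn]; first by rewrite expr0 !mul1r expr1 lerDr.
have tdn : t ^+ n.+1 <= (t + d) ^+ n.+1.
  by rewrite lerXn2r ?nnegrE//; lra.
have -> : n.+2%:R * t ^+ n.+1 * d = t * (n.+1%:R * t ^+ n * d) + d * t ^+ n.+1.
  by rewrite -natr1 exprS; ring.
rewrite [leRHS]exprS mulrDl; apply: lerD; apply: ler_wpM2l => //; exact: ltW.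
Qed.

(* By induction on [n], since the remainder [E_n] at rank [n] satisfies
   [E_(n+1) = (z + h) E_n + n h^2 z^(n-1)]. *)
Lemma expr_taylor2_modulus (R : realType) (z h : R[i]) (t d : R) n :
  0 < d -> modulus z <= t -> modulus h <= d ->
  modulus ((z + h) ^+ n.+1 - z ^+ n.+1 - n.+1%:R * h * z ^+ n) <=
    (modulus h / d) ^+ 2 * (t + d *+ 2) ^+ n.+1.
Proof.
move=> d0 zt hd.
have z0 := modulus_ge0 z; have h0 := modulus_ge0 h.
have t0 : 0 <= t by lra.
elim: n => [|n IHn].
  rewrite !expr1 expr0 mulr1 mul1r (_ : _ - _ = 0) ?modulus0; last by ring.
  by rewrite mulr_ge0// ?sqr_ge0//; lra.
rewrite (_ : _ - _ = (z + h) * ((z + h) ^+ n.+1 - z ^+ n.+1 - n.+1%:R * h * z ^+ n)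
    + n.+1%:R * h ^+ 2 * z ^+ n); last first.
  by rewrite -[n.+2%:R]natr1 !exprS; ring.
apply: le_trans (ler_modulusD _ _) _.
rewrite !modulusM !modulusX modulus_nat.
have -> : (modulus h / d) ^+ 2 * (t + d *+ 2) ^+ n.+2 =
  (t + d) * ((modulus h / d) ^+ 2 * (t + d *+ 2) ^+ n.+1) +
  (modulus h / d) ^+ 2 * (d * (t + d *+ 2) ^+ n.+1).
  by rewrite [X in _ * X]exprS mulr2n; ring.
apply: lerD.
  apply: ler_pM => //; try exact: modulus_ge0.
  by apply: le_trans (ler_modulusD _ _) _; exact: lerD.
have -> : (modulus h / d) ^+ 2 * (d * (t + d *+ 2) ^+ n.+1) =
    modulus h ^+ 2 * ((t + d *+ 2) ^+ n.+1 / d).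
  by field; rewrite lt0r_neq0.
rewrite [leLHS](_ : _ = modulus h ^+ 2 * (n.+1%:R * modulus z ^+ n)); last by ring.
rewrite ler_wpM2l ?sqr_ge0// ler_pdivlMr//.
apply: (@le_trans _ _ ((t + d) ^+ n.+1)); last first.
  by rewrite lerXn2r ?nnegrE ?mulr2n//; lra.
apply: le_trans (natmul_expr_le n t0 d0).
apply: ler_wpM2r; first exact: ltW.
by apply: ler_wpM2l => //; rewrite lerXn2r ?nnegrE.
Qed.

(** An explicit quadratic remainder instead of a limit: it passes to [Re], [Im] and lines by plain
    inequalities, and yields both the derivative and continuity. *)
Definition quad_diff (R : realType) (F : R[i] -> R[i]) (F' z : R[i]) : Prop :=
  exists (C d : R), 0 < d /\ forall h, modulus h < d ->
    modulus (F (z + h) - F z - h * F') <= C * modulus h ^+ 2.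

Lemma geometric_sum_le (R : realFieldType) (q : R) n : 0 <= q < 1 ->
  \sum_(i < n) q ^+ i <= (1 - q)^-1.
Proof.
move=> /andP[q0 q1].
have : (1 - q) * \sum_(i < n) q ^+ i = 1 - q ^+ n.
  by rewrite -[RHS]opprB subrX1 -mulNr opprB.
move=> qE; rewrite -[leRHS]mulr1 ler_pdivlMl ?subr_gt0// qE.
by rewrite gerBl exprn_ge0.
Qed.

(** Each term has a quadratic remainder by [expr_taylor2_modulus]. The bound on [a n] sums these
    remainders geometrically, uniformly in the number of terms, and the estimate passes to the
    limit. *)
Lemma power_series_quad_diff (R : realType) (a : nat -> R[i]) (s M : R)
    (F : R[i] -> R[i]) (z : R[i]) :
  (forall n, modulus (a n) * s ^+ n <= M) ->
  (forall w, modulus w < s ->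
    series (fun n => a n * w ^+ n : R[i]^o) n @[n --> \oo] --> (F w : R[i]^o)) ->
  modulus z < s ->
  exists F', series (fun n => n.+1%:R * a n.+1 * z ^+ n : R[i]^o) n @[n --> \oo]
    --> (F' : R[i]^o) /\ quad_diff F F' z.
Proof.
move=> aM aF zs; set t := modulus z in zs *.
have t0 : 0 <= t by exact: modulus_ge0.
have s0 : 0 < s by lra.
have M0 : 0 <= M by apply: le_trans (aM 0); rewrite mulr1 modulus_ge0.
(* This puts [t + 2 d] at the midpoint of [t] and [s], so the remainder estimate, which involves
   powers of [t + 2 d], still has ratio below 1. *)
pose d := (s - t) / 4.
have d0 : 0 < d by rewrite /d; lra.
have tds : t + d *+ 2 < s by rewrite mulr2n /d; lra.
have aq r n : 0 <= r -> modulus (a n) * r ^+ n <= M * (r / s) ^+ n.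
  move=> r0; rewrite expr_div_n mulrA ler_pdivlMr ?exprn_gt0// mulrAC.
  by rewrite ler_wpM2r// exprn_ge0.
have [F' aF'] : exists F' : R[i], series (fun n => n.+1%:R * a n.+1 * z ^+ n : R[i]^o) n
    @[n --> \oo] --> (F' : R[i]^o).
  (* The increment [d] absorbs the factor [n.+1] of the derived series. *)
  pose q := (t + d) / s.
  have q0 : 0 <= q by rewrite divr_ge0//; lra.
  have q1 : q < 1 by rewrite ltr_pdivrMr//; move: tds; rewrite mulr2n; lra.
  apply: (@complex_series_cvg _ _ (geometric (M / d * q) q)).
    move=> n; rewrite !modulusM modulusX modulus_nat -/t /=.
    have -> : M / d * q * q ^+ n = M * q ^+ n.+1 / d by rewrite exprS; ring.
    rewrite ler_pdivlMr//; apply: le_trans (aq (t + d) n.+1 _); last lra.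
    rewrite -!mulrA mulrCA ler_wpM2l ?modulus_ge0// mulrA.
    exact: natmul_expr_le.
  by apply: is_cvg_geometric_series; rewrite ger0_norm.
exists F'; split=> //.
pose q := (t + d *+ 2) / s.
have td0 : 0 <= t + d *+ 2 by rewrite mulr2n; lra.
have q0 : 0 <= q by rewrite divr_ge0// ltW.
have q1 : q < 1 by rewrite ltr_pdivrMr// mul1r.
exists (M * q * (1 - q)^-1 / d ^+ 2), d; split=> // h hd.
pose T n := a n.+1 * ((z + h) ^+ n.+1 - z ^+ n.+1 - n.+1%:R * h * z ^+ n).
have zhs : modulus (z + h) < s.
  by apply: le_lt_trans (ler_modulusD _ _) _; rewrite -/t; move: tds; rewrite mulr2n; lra.
pose S w := series (fun n => a n * w ^+ n : R[i]^o).
pose S' := series (fun n => n.+1%:R * a n.+1 * z ^+ n : R[i]^o).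
(* Shifted by one: the constant term cancels in the difference, and the remaining [n] terms of [S]
   match the [n] terms of [S']. *)
have cvS w : modulus w < s -> (S w n.+1 : R[i]^o) @[n --> \oo] --> (F w : R[i]^o).
  by move=> /aF; rewrite -cvg_shiftS.
have cvT : (S (z + h) n.+1 - S z n.+1 - h *: S' n : R[i]^o) @[n --> \oo] -->
    (F (z + h) - F z - h * F' : R[i]^o).
  exact: cvgB (cvgB (cvS _ zhs) (cvS _ zs)) (@cvgZl_tmp _ R[i]^o _ _ _ h _ _ aF').
apply: (modulus_cvg_le cvT) => n.
have -> : S (z + h) n.+1 - S z n.+1 - h *: S' n = \sum_(i < n) T i.
  rewrite /S /S' /series/= !big_nat_recl// !expr0 !mulr1.
  rewrite -[h *: _]/(h * _) mulr_sumr !big_mkord.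
  rewrite opprD addrACA subrr add0r -!sumrB.
  by apply: eq_bigr => i _; rewrite /T; ring.
have Tq i : modulus (T i) <= modulus h ^+ 2 * (M * q / d ^+ 2) * q ^+ i.
  rewrite modulusM.
  apply: (@le_trans _ _ (modulus (a i.+1) *
      ((modulus h / d) ^+ 2 * (t + d *+ 2) ^+ i.+1))).
    apply: ler_wpM2l; first exact: modulus_ge0.
    by apply: expr_taylor2_modulus => //; exact: ltW.
  have -> : modulus h ^+ 2 * (M * q / d ^+ 2) * q ^+ i =
      (modulus h / d) ^+ 2 * (M * q ^+ i.+1).
    by rewrite (exprS q i); field; rewrite lt0r_neq0.
  by rewrite mulrCA ler_wpM2l ?sqr_ge0// aq.
apply: (@le_trans _ _ (\sum_(i < n) modulus (T i))).
  elim/big_ind2 : _ => [|x x' y y' xx' yy'|//]; first by rewrite modulus0.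
  by apply: le_trans (ler_modulusD _ _) _; exact: lerD.
apply: le_trans; first by apply: ler_sum => i _; exact: Tq.
rewrite -mulr_sumr [leRHS](_ : _ =
  modulus h ^+ 2 * (M * q / d ^+ 2) * (1 - q)^-1); last by ring.
apply: ler_wpM2l; last by apply: geometric_sum_le; rewrite q0.
by rewrite mulr_ge0 ?sqr_ge0// divr_ge0 ?sqr_ge0// mulr_ge0.
Qed.

Lemma quad_diff_cderiv (R : realType) (F : R[i] -> R[i]) (F' z : R[i]) :
  quad_diff F F' z -> cderiv F z = F'.
Proof.
move=> [C [d [d0 FC]]]; rewrite /cderiv /derive1.
apply: (@cvg_lim R[i]^o); first exact: norm_hausdorff.
apply/cvgrPdist_lt => -[e e'] e0.
have [e'0 {}e0] : e' = 0 /\ 0 < e.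
  by move: e0; rewrite ltcE/= => /andP[/eqP <-].
rewrite e'0 -[e +i* 0]/(e%:C) => {e' e'0}.
(* The constant [C] may be zero or negative, hence the denominator. *)
pose r := Num.min d (e / (`|C| + 1)).
have C1 : 0 < `|C| + 1 by have := normr_ge0 C; lra.
have r0 : 0 < r by rewrite lt_min d0 divr_gt0.
apply/nbhs_ballP; exists r%:C => /=; first by rewrite ltcR.
move=> h /=; rewrite -ball_normE/= sub0r normrN normCE ltcR lt_min => /andP[hd he] h0.
rewrite normCE ltcR -[_ *: _]/(_ * _).
have mh0 : 0 < modulus h.
  by rewrite lt0r modulus_ge0 andbT; apply: contra h0 => /eqP/Normc.eq0_normc ->.
have -> : F' - h^-1 * (F (h + z) - F z) = - (h^-1 * (F (z + h) - F z - h * F')).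
  by rewrite [z + h]addrC; field.
rewrite modulusN modulusM; have -> : modulus h^-1 = (modulus h)^-1 by exact: Normc.normcV.
rewrite mulrC ltr_pdivrMr//; apply: le_lt_trans (FC h hd) _.
rewrite expr2 mulrA ltr_pM2r//.
move: he; rewrite ltr_pdivlMr//; have := ler_norm C; nra.
Qed.

(** Convergence at the real point [s] makes the terms tend to 0: beyond some [N] they are below 1,
    and the first [N] are bounded by their sum. *)
Lemma power_series_coef_bound (R : realType) (a : nat -> R[i]) (r s : R)
    (F : R[i] -> R[i]) : 0 < s < r ->
  (forall w, modulus w < r ->
    series (fun n => a n * w ^+ n : R[i]^o) n @[n --> \oo] --> (F w : R[i]^o)) ->
  exists M, forall n, modulus (a n) * s ^+ n <= M.
Proof.
move=> /andP[s0 sr] aF.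
have : cvgn (series (fun n => a n * s%:C ^+ n : R[i]^o)).
  by apply/cvg_ex; exists (F s%:C); apply: aF; rewrite modulus_real gtr0_norm.
move=> /cvg_series_cvg_0/modulus_cvgP/(_ 1 ltr01)[N _ aN].
exists (1 + \sum_(i < N) modulus (a i) * s ^+ i) => n.
have p0 i : 0 <= modulus (a i) * s ^+ i.
  by rewrite mulr_ge0 ?modulus_ge0 ?exprn_ge0 ?ltW.
have [Nn|nN] := leqP N n.
  have := aN n Nn; rewrite /= sub0r modulusN modulusM modulusX modulus_real gtr0_norm//.
  by move=> /ltW h; apply: le_trans h _; rewrite lerDl sumr_ge0.
rewrite (bigD1 (Ordinal nN))//= addrCA lerDl addr_ge0// sumr_ge0//.
Qed.

(** The conclusion covers a whole disc, with one sequence [b], so that [cderiv F] is again analytic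
    and the argument can be iterated. *)
Lemma analytic_on_derive (R : realType) (D : set R[i]) (F : R[i] -> R[i]) (z0 : R[i]) :
  analytic_on D F -> D z0 -> exists (b : nat -> R[i]) (r : R), 0 < r /\
    forall z, modulus (z - z0) < r -> quad_diff F (cderiv F z) z /\
      series (fun n => b n * (z - z0) ^+ n : R[i]^o) n @[n --> \oo]
        --> (cderiv F z : R[i]^o).
Proof.
move=> DF /DF[a [r [r0 aF]]].
exists (fun n => n.+1%:R * a n.+1), r; split=> // z zr.
pose G w := F (z0 + w).
have aG w : modulus w < r ->
    series (fun n => a n * w ^+ n : R[i]^o) n @[n --> \oo] --> (G w : R[i]^o).
  by move=> wr; have := aF (z0 + w); rewrite [z0 + w]addrC addrK addrC; apply.
have zr0 := modulus_ge0 (z - z0).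
(* An intermediate radius: the coefficient bound needs [s < r], the expansion at [z] needs
   [modulus (z - z0) < s]. *)
pose s := (modulus (z - z0) + r) / 2.
have s0r : 0 < s < r by rewrite /s; lra.
have [M aM] := power_series_coef_bound s0r aG.
have [w ws||F' [aF' GF']] := power_series_quad_diff (F := G) (z := z - z0) aM.
- by apply: aG; apply: lt_trans ws _; case/andP: s0r.
- by rewrite /s; lra.
have FF' : quad_diff F F' z.
  case: GF' => C [d [d0 GC]]; exists C, d; split=> // h /GC.
  by rewrite /G addrA [z0 + _]addrC subrK.
by rewrite (quad_diff_cderiv FF').
Qed.

Lemma analytic_on_quad_diff (R : realType) (D : set R[i]) (F : R[i] -> R[i]) z :
  analytic_on D F -> D z -> quad_diff F (cderiv F z) z.
Proof.
move=> DF Dz; have [b [r [r0 /(_ z)[]]]] := analytic_on_derive DF Dz => //.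
by rewrite subrr modulus0.
Qed.

Lemma analytic_on_cderiv (R : realType) (D : set R[i]) (F : R[i] -> R[i]) :
  analytic_on D F -> analytic_on D (cderiv F).
Proof.
move=> DF z0 /(analytic_on_derive DF)[b [r [r0 H]]].
by exists b, r; split=> // z /H[].
Qed.

(** * Real partial derivatives of a complex differentiable function *)

Lemma quad_is_derive (R : realType) (f : R -> R) (x l : R) :
  (exists C d : R, 0 < d /\
    forall t : R, `|t| < d -> `|f (x + t) - f x - t * l| <= C * t ^+ 2) ->
  is_derive x 1 f l.
Proof.
move=> [C [d [d0 fC]]].
suff fl : h^-1 *: (f (h *: 1 + x) - f x) @[h --> 0^'] --> l.
  apply: DeriveDef; first by apply/cvg_ex; exists l.
  exact: (cvg_lim (@Rhausdorff R)).
apply/cvgrPdist_lt => e e0.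
have C1 : 0 < `|C| + 1 by have := normr_ge0 C; lra.
have r0 : 0 < Num.min d (e / (`|C| + 1)) by rewrite lt_min d0 divr_gt0.
apply/nbhs_ballP; exists (Num.min d (e / (`|C| + 1))) => //= h.
rewrite -ball_normE/= sub0r normrN lt_min => /andP[hd he] h0.
have nh0 : 0 < `|h| by rewrite normr_gt0.
have -> : l - h^-1 *: (f (h *: 1 + x) - f x) = - (h^-1 * (f (x + h) - f x - h * l)).
  by rewrite -![_ *: _]/(_ * _) mulr1 [x + h]addrC; field.
rewrite normrN normrM normfV mulrC ltr_pdivrMr//; apply: le_lt_trans (fC h hd) _.
rewrite -real_normK ?num_real// expr2 mulrA ltr_pM2r//.
by move: he; rewrite ltr_pdivlMr//; have := ler_norm C; nra.
Qed.

Section complex_derivative_slices.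
Variables (R : realType) (F : R[i] -> R[i]) (F' : R[i]) (x y : R).
Hypothesis FF' : quad_diff F F' (x +i* y).

(** One statement for four partial derivatives: [T] is [Re] or [Im], and [w] is 1 or ['i]. The
    complex derivative along [w] is [w * F'], and [T] does not enlarge the remainder. *)
Let slice (w : R[i]) (f : R -> R[i]) (T : R[i] -> R) (t0 : R) :
  {morph T : a b / a - b} -> (forall (t : R) a, T (t%:C * a) = t * T a) ->
  (forall a, `|T a| <= modulus a) ->
  modulus w = 1 -> (forall t, f (t0 + t) = F (x +i* y + t%:C * w)) ->
  is_derive t0 1 (fun t => T (f t)) (T (w * F')).
Proof.
move=> TB TZ Tle w1 fE; case: FF' => C [d [d0 FC]].
apply: quad_is_derive; exists C, d; split=> // t td.
have mt : modulus (t%:C * w) = `|t| by rewrite modulusM w1 mulr1 modulus_real.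
have := FC (t%:C * w); rewrite mt real_normK ?num_real// => /(_ td).
apply: le_trans; apply: le_trans (Tle _).
have fE0 := fE 0; rewrite addr0 mul0r addr0 in fE0.
by rewrite !TB fE fE0 -mulrA TZ.
Qed.

Let ReZ (t : R) (a : R[i]) : complex.Re (t%:C * a) = t * complex.Re a.
Proof. by case: a => a b; rewrite /= mul0r subr0. Qed.

Let ImZ (t : R) (a : R[i]) : complex.Im (t%:C * a) = t * complex.Im a.
Proof. by case: a => a b; rewrite /= mul0r addr0. Qed.

Let shiftx (t : R) : (x + t) +i* y = x +i* y + t%:C * 1.
Proof. by rewrite mulr1; apply/eqP; rewrite eq_complex/= addr0 !eqxx. Qed.

Let shifty (t : R) : x +i* (y + t) = x +i* y + t%:C * 'i.
Proof.
apply/eqP; rewrite eq_complex/=.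
by rewrite !mul0r !mulr0 !mulr1 subrr !addr0 !eqxx.
Qed.

Let modulusi : modulus ('i : R[i]) = 1.
Proof. by rewrite /modulus/= expr0n/= expr1n add0r sqrtr1. Qed.

Let modulus1 : modulus (1 : R[i]) = 1. Proof. exact: Normc.normc1. Qed.

Lemma is_derive_Re_x : is_derive x 1 (fun t => complex.Re (F (t +i* y))) (complex.Re F').
Proof.
rewrite -[F']mul1r; apply: (slice (f := fun t => F (t +i* y))) => //.
- exact: raddfB.
- exact: ler_Re_modulus.
- by move=> t; rewrite shiftx.
Qed.

Lemma is_derive_Im_x : is_derive x 1 (fun t => complex.Im (F (t +i* y))) (complex.Im F').
Proof.
rewrite -[F']mul1r; apply: (slice (f := fun t => F (t +i* y))) => //.
- exact: raddfB.
- exact: ler_Im_modulus.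
- by move=> t; rewrite shiftx.
Qed.

Lemma is_derive_Re_y : is_derive y 1 (fun t => complex.Re (F (x +i* t))) (- complex.Im F').
Proof.
(* The vertical derivative is ['i * F']: the Cauchy-Riemann equations. *)
have -> : - complex.Im F' = complex.Re ('i * F').
  by case: F' => a b /=; rewrite mul0r mul1r add0r.
apply: (slice (f := fun t => F (x +i* t))) => //.
- exact: raddfB.
- exact: ler_Re_modulus.
- by move=> t; rewrite shifty.
Qed.

Lemma is_derive_Im_y : is_derive y 1 (fun t => complex.Im (F (x +i* t))) (complex.Re F').
Proof.
have -> : complex.Re F' = complex.Im ('i * F').
  by case: F' => a b /=; rewrite mul0r mul1r add0r.
apply: (slice (f := fun t => F (x +i* t))) => //.
- exact: raddfB.
- exact: ler_Im_modulus.
- by move=> t; rewrite shifty.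
Qed.

Let continuous_slice (T : R[i] -> R) :
  {morph T : a b / a - b} -> (forall a, `|T a| <= modulus a) ->
  {for (x, y), continuous (fun p => T (F (toC p)))}.
Proof.
move=> TB Tle; case: FF' => C [d [d0 FC]].
apply/cvgrPdist_lt => e e0.
(* For [modulus h <= 1] the quadratic remainder is at most [|C| * modulus h], so [B] is a Lipschitz
   constant at the point; the 1 keeps it positive. *)
pose B := `|C| + modulus F' + 1.
have B1 : 1 <= B by have := normr_ge0 C; have := modulus_ge0 F'; rewrite /B; lra.
pose r := Num.min (Num.min d 1) (e / B).
have r0 : 0 < r by rewrite /r !lt_min d0 ltr01 divr_gt0//; lra.
(* Balls of the product are squares, and the modulus is bounded by the sum of the two coordinates;
   hence the half. *)
apply/(@nbhs_ballP R (R * R)%type); exists (r / 2) => /=; first by rewrite divr_gt0.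
move=> [x' y'] [/=]; rewrite /ball/= => x'x y'y.
pose h : R[i] := (x' - x) +i* (y' - y).
have hr : modulus h < r.
  apply: le_lt_trans (modulus_le_ReIm _) _ => /=.
  by rewrite [r]splitr distrC [`|y' - y|]distrC; exact: ltrD.
have zh : toC (x', y') = x +i* y + h.
  by apply/eqP; rewrite eq_complex/= !subrKC !eqxx.
rewrite zh distrC -TB; apply: le_lt_trans (Tle _) _.
rewrite /r !lt_min in hr; case/andP: hr => /andP[hd h1] he.
have := FC h hd; have := ler_modulusD (F (x +i* y + h) - F (x +i* y) - h * F') (h * F').
rewrite subrK modulusM => h2 h3.
have h0 := modulus_ge0 h.
apply: (@le_lt_trans _ _ (modulus h * B)); last by rewrite -ltr_pdivlMr//; exact: lt_le_trans B1.
apply: le_trans h2 _; rewrite /B !mulrDr mulr1 [in leRHS]addrAC lerD2r//.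
apply: le_trans h3 _.
have C0 : 0 <= `|C| - C by rewrite subr_ge0 ler_norm.
have hh : 0 <= modulus h * (1 - modulus h) by rewrite mulr_ge0//; lra.
have : 0 <= modulus h ^+ 2 * (`|C| - C) by rewrite mulr_ge0// sqr_ge0.
have : 0 <= `|C| * (modulus h * (1 - modulus h)) by rewrite mulr_ge0.
lra.
Qed.

Lemma continuous_Re_toC : {for (x, y), continuous (fun p => complex.Re (F (toC p)))}.
Proof. apply: continuous_slice; [exact: raddfB|exact: ler_Re_modulus]. Qed.

Lemma continuous_Im_toC : {for (x, y), continuous (fun p => complex.Im (F (toC p)))}.
Proof. apply: continuous_slice; [exact: raddfB|exact: ler_Im_modulus]. Qed.

End complex_derivative_slices.

(** * The Hardy inequality attached to a vector field *)

Lemma is_derive_d1 (R : realType) (f : R * R -> R) (x y : R) :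
  differentiable f (x, y) -> is_derive x 1 (fun t => f (t, y)) (d1 f (x, y)).
Proof.
move=> /(diff_derivable (v := (1, 0) : R * R)) df.
have E : (fun h : R => h^-1 *: (f (h *: (1 : R) + x, y) - f (x, y))) =
    (fun h : R => h^-1 *: (f (h *: ((1, 0) : R * R) + (x, y)) - f (x, y))).
  by apply/funext => h; congr (_ *: (f _ - _)); congr pair; rewrite /= scaler0 add0r.
by apply: DeriveDef; [rewrite /derivable /= E | rewrite /derive /= E].
Qed.

Lemma is_derive_d2 (R : realType) (f : R * R -> R) (x y : R) :
  differentiable f (x, y) -> is_derive y 1 (fun t => f (x, t)) (d2 f (x, y)).
Proof.
move=> /(diff_derivable (v := (0, 1) : R * R)) df.
have E : (fun h : R => h^-1 *: (f (x, h *: (1 : R) + y) - f (x, y))) =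
    (fun h : R => h^-1 *: (f (h *: ((0, 1) : R * R) + (x, y)) - f (x, y))).
  by apply/funext => h; congr (_ *: (f _ - _)); congr pair; rewrite /= scaler0 add0r.
by apply: DeriveDef; [rewrite /derivable /= E | rewrite /derive /= E].
Qed.

Section hardy_from_vector_field.
Variables (R : realType) (Om K : set (R * R)).
Hypotheses (cK : compact K) (KOm : K `<=` Om).

Let oK : open (~` K).
Proof. by rewrite openC; apply: compact_closed cK; exact: norm_hausdorff. Qed.

(** The plane is covered by [Om], where regularity is assumed, and by the open complement of [K],
    where [f] is locally zero. Global regularity thus follows whatever the field does outside
    [Om]. *)
Lemma continuous_supported (f : R * R -> R) :
  (forall z, Om z -> {for z, continuous f}) -> (forall z, ~ K z -> f z = 0) ->
  continuous f.
Proof.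
move=> cf f0 z; have [/KOm/cf//|nKz] := pselect (K z).
rewrite /continuous_at f0//; apply: cvg_near_cst.
by apply: filterS (open_nbhs_nbhs (conj oK nKz)) => w /f0.
Qed.

Lemma d1_supported (f : R * R -> R) : (forall z, ~ K z -> f z = 0) ->
  forall z, ~ K z -> d1 f z = 0.
Proof.
move=> f0 z nKz; rewrite /d1 (@near_eq_derive _ _ _ f (cst 0)) ?derive_cst//.
by apply: filterS (open_nbhs_nbhs (conj oK nKz)) => w /f0.
Qed.

Lemma d2_supported (f : R * R -> R) : (forall z, ~ K z -> f z = 0) ->
  forall z, ~ K z -> d2 f z = 0.
Proof.
move=> f0 z nKz; rewrite /d2 (@near_eq_derive _ _ _ f (cst 0)) ?derive_cst//.
by apply: filterS (open_nbhs_nbhs (conj oK nKz)) => w /f0.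
Qed.

Lemma is_derive_supported_x (f df : R * R -> R) :
  (forall x y, Om (x, y) -> is_derive x 1 (fun t => f (t, y)) (df (x, y))) ->
  (forall z, ~ K z -> f z = 0) -> (forall z, ~ K z -> df z = 0) ->
  forall x y : R, is_derive x 1 (fun t => f (t, y)) (df (x, y)).
Proof.
move=> fP f0 df0 x y; have [/KOm/fP//|nKz] := pselect (K (x, y)).
rewrite df0//; apply: (@near_eq_is_derive _ _ _ (cst 0)).
have : \near x, (~` K) (x, y).
  exact: (slice_continuous_x (open_nbhs_nbhs (conj oK nKz))).
by apply: filterS => t /f0 /= ->.
Qed.

Lemma is_derive_supported_y (f df : R * R -> R) :
  (forall x y, Om (x, y) -> is_derive y 1 (fun t => f (x, t)) (df (x, y))) ->
  (forall z, ~ K z -> f z = 0) -> (forall z, ~ K z -> df z = 0) ->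
  forall x y : R, is_derive y 1 (fun t => f (x, t)) (df (x, y)).
Proof.
move=> fP f0 df0 x y; have [/KOm/fP//|nKz] := pselect (K (x, y)).
rewrite df0//; apply: (@near_eq_is_derive _ _ _ (cst 0)).
have : \near y, (~` K) (x, y).
  exact: (slice_continuous_y (open_nbhs_nbhs (conj oK nKz))).
by apply: filterS => t /f0 /= ->.
Qed.

Variables (u v V1 V2 dV1 dV2 W : R * R -> R) (c : R).
Hypotheses (u1 : Ck 1 u) (v1 : Ck 1 v).
Hypotheses (u0 : forall z, ~ K z -> u z = 0) (v0 : forall z, ~ K z -> v z = 0).
Hypotheses
  (V1P : forall x y, Om (x, y) -> is_derive x 1 (fun t => V1 (t, y)) (dV1 (x, y)))
  (V2P : forall x y, Om (x, y) -> is_derive y 1 (fun t => V2 (x, t)) (dV2 (x, y)))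
  (cV1 : forall z, Om z -> {for z, continuous V1})
  (cV2 : forall z, Om z -> {for z, continuous V2})
  (cdV1 : forall z, Om z -> {for z, continuous dV1})
  (cdV2 : forall z, Om z -> {for z, continuous dV2})
  (c0 : 0 < c)
  (WV : forall z, Om z -> c * W z = dV1 z + dV2 z - V1 z ^+ 2 - V2 z ^+ 2).

(* Integrate |grad w + w V|^2 >= 0 for w = u + i v: the cross term is
   V . grad |w|^2 = div (|w|^2 V) - |w|^2 div V. *)
Lemma hardy_from_vector_field :
  (c%:E * \int[@lebesgue2 R]_(x in Om) (W x * (u x ^+ 2 + v x ^+ 2))%:E <=
   \int[@lebesgue2 R]_(x in Om)
     (d1 u x ^+ 2 + d2 u x ^+ 2 + (d1 v x ^+ 2 + d2 v x ^+ 2))%:E)%E.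
Proof.
have [du /= cu1 cu2] := u1; have [dv /= cv1 cv2] := v1.
have cu : continuous u by move=> z; exact: differentiable_continuous.
have cv : continuous v by move=> z; exact: differentiable_continuous.
pose U z := u z ^+ 2 + v z ^+ 2.
pose grad z := d1 u z ^+ 2 + d2 u z ^+ 2 + (d1 v z ^+ 2 + d2 v z ^+ 2).
pose WU z := c * (W z * U z).
pose G1 z := U z * V1 z; pose G2 z := U z * V2 z.
pose dG1 z := (u z * d1 u z + v z * d1 v z) * 2 * V1 z + U z * dV1 z.
pose dG2 z := (u z * d2 u z + v z * d2 v z) * 2 * V2 z + U z * dV2 z.
have U0 z : ~ K z -> U z = 0 by move=> nKz; rewrite /U u0// v0// expr0n addr0.
have grad0 z : ~ K z -> grad z = 0.
  move=> nKz; rewrite /grad !(d1_supported, d2_supported)//.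
  by rewrite expr0n/= !addr0.
have WU0 z : ~ K z -> WU z = 0 by move=> nKz; rewrite /WU U0// !mulr0.
have G10 z : ~ K z -> G1 z = 0 by move=> nKz; rewrite /G1 U0// mul0r.
have G20 z : ~ K z -> G2 z = 0 by move=> nKz; rewrite /G2 U0// mul0r.
have dG10 z : ~ K z -> dG1 z = 0.
  by move=> nKz; rewrite /dG1 U0// u0// v0// !(mul0r, addr0).
have dG20 z : ~ K z -> dG2 z = 0.
  by move=> nKz; rewrite /dG2 U0// u0// v0// !(mul0r, addr0).
have csqr (f : R * R -> R) z : {for z, continuous f} ->
    {for z, continuous (fun z => f z ^+ 2)}.
  by move=> cf; exact: cvgM.
have cU : continuous U by move=> z; apply: cvgD; apply: csqr; [exact: cu|exact: cv].
have cgrad : continuous grad.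
  move=> z; apply: cvgD; apply: cvgD; apply: csqr.
  - exact: cu1.
  - exact: cu2.
  - exact: cv1.
  - exact: cv2.
have cWU : continuous WU.
  (* Continuity is assumed for the field and its derivatives, not for [W]; on [K] the relation [WV]
     expresses [c * W] through them. *)
  have -> : WU = fun z => (dV1 z + dV2 z - V1 z ^+ 2 - V2 z ^+ 2) * U z.
    apply/funext => z; have [/KOm/WV <-|nKz] := pselect (K z).
      by rewrite /WU mulrA.
    by rewrite WU0// U0// mulr0.
  apply: continuous_supported => [z Omz|z nKz]; last by rewrite U0// mulr0.
  apply: cvgM; last exact: cU.
  apply: cvgB; last by apply: csqr; exact: cV2.
  apply: cvgB; last by apply: csqr; exact: cV1.
  by apply: cvgD; [exact: cdV1|exact: cdV2].
have cdG1 : continuous dG1.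
  apply: continuous_supported dG10 => z Omz; apply: cvgD; apply: cvgM.
  - apply: cvgM; last exact: cvg_cst.
    by apply: cvgD; apply: cvgM; [exact: cu|exact: cu1|exact: cv|exact: cv1].
  - exact: cV1.
  - exact: cU.
  - exact: cdV1.
have cdG2 : continuous dG2.
  apply: continuous_supported dG20 => z Omz; apply: cvgD; apply: cvgM.
  - apply: cvgM; last exact: cvg_cst.
    by apply: cvgD; apply: cvgM; [exact: cu|exact: cu2|exact: cv|exact: cv2].
  - exact: cV2.
  - exact: cU.
  - exact: cdV2.
have G1P : forall x y : R, is_derive x 1 (fun t => G1 (t, y)) (dG1 (x, y)).
  apply: is_derive_supported_x => // x y Omxy.
  have ux := is_derive_d1 (du (x, y)); have vx := is_derive_d1 (dv (x, y)).
  have Vx := V1P Omxy.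
  by apply: is_derive_eq; rewrite /dG1 /U /GRing.scale/=; ring.
have G2P : forall x y : R, is_derive y 1 (fun t => G2 (x, t)) (dG2 (x, y)).
  apply: is_derive_supported_y => // x y Omxy.
  have ux := is_derive_d2 (du (x, y)); have vx := is_derive_d2 (dv (x, y)).
  have Vx := V2P Omxy.
  by apply: is_derive_eq; rewrite /dG2 /U /GRing.scale/=; ring.
have iWU := continuous_integrable_prod cK cWU WU0.
have igrad := continuous_integrable_prod cK cgrad grad0.
have idG1 := continuous_integrable_prod cK cdG1 dG10.
have idG2 := continuous_integrable_prod cK cdG2 dG20.
have restrict (f : R * R -> R) : (forall z, ~ K z -> f z = 0) ->
    (\int[@lebesgue2 R]_(x in Om) (f x)%:E = \int[@lebesgue2 R]_x (f x)%:E)%E.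
  move=> f0; rewrite integral_mkcond; congr (integral _ _ _).
  apply/funext => z; rewrite patchE; case: ifPn => // /negP Omz.
  by rewrite f0// => /KOm/mem_set.
rewrite !restrict//; last by move=> z nKz; rewrite -/(U z) U0// mulr0.
rewrite -integralZl//=; last first.
  have -> : (fun z => (W z * (u z ^+ 2 + v z ^+ 2))%:E) = EFin \o (fun z => c^-1 * WU z).
    by apply/funext => z; rewrite /WU /= mulKf ?lt0r_neq0.
  apply: continuous_integrable_prod cK _ _ => [z|z nKz]; last by rewrite WU0// mulr0.
  by apply: cvgM; [exact: cvg_cst|exact: cWU].
apply: (@le_trans _ _ (\int[@lebesgue2 R]_x ((grad x)%:E + ((dG1 x)%:E + (dG2 x)%:E)))%E).
  apply: le_integral => //.
  - exact: (integrableD _ igrad (integrableD _ idG1 idG2)).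
  move=> z _; rewrite -!EFinD lee_fin.
  have [/KOm/WV WVz|nKz] := pselect (K z); last first.
    by rewrite dG10// dG20// !addr0 -/(U z) U0// !mulr0 /grad !addr_ge0// sqr_ge0.
  rewrite mulrA WVz -subr_ge0 /grad /dG1 /dG2 /U.
  rewrite (_ : _ - _ = (d1 u z + u z * V1 z) ^+ 2 + (d2 u z + u z * V2 z) ^+ 2 +
    ((d1 v z + v z * V1 z) ^+ 2 + (d2 v z + v z * V2 z) ^+ 2)); last by ring.
  by rewrite !addr_ge0// sqr_ge0.
rewrite integralD//; last exact: (integrableD _ idG1 idG2).
rewrite integralD// (integral_d1_eq0 cK G10 dG10 cdG1 G1P).
by rewrite (integral_d2_eq0 cK G20 dG20 cdG2 G2P) !adde0.
Qed.

End hardy_from_vector_field.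

(** * The radial profile of the field *)

(* [hardy_coef r = - h' r / r], where [h r = log phi] as a function of
   [r = |F|]. *)
Definition hardy_coef (R : realType) (rho rad r : R) : R :=
  (2^-1 - r / 2 * (r - rho)^-1 + r / 2 * (rad - r)^-1) / r ^+ 2.

Definition hardy_coef' (R : realType) (rho rad r : R) : R :=
  (- (2^-1 * (r - rho)^-1) + r / 2 * (r - rho) ^- 2
   + 2^-1 * (rad - r)^-1 + r / 2 * (rad - r) ^- 2) / r ^+ 2
  - 2 * hardy_coef rho rad r / r.

Lemma is_derive_hardy_coef (R : realType) (rho rad r : R) :
  0 < rho -> rho < r < rad ->
  is_derive r 1 (hardy_coef rho rad) (hardy_coef' rho rad r).
Proof.
move=> rho0 /andP[r1 r2].
have r0 : r ^+ 2 != 0 by rewrite expf_neq0// lt0r_neq0//; lra.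
have a0 : r - rho != 0 by lra.
have b0 : rad - r != 0 by lra.
have D1 : is_derive r 1 (fun t : R => t - rho) 1.
  by apply: is_derive_eq; ring.
have D2 : is_derive r 1 (fun t : R => rad - t) (-1).
  by apply: is_derive_eq; ring.
have D3 : is_derive r 1 (fun t : R => t ^+ 2) (2 * r).
  by apply: is_derive_eq; rewrite /GRing.scale/=; ring.
have Da := is_deriveV (f := fun t => t - rho) a0 D1.
have Db := is_deriveV (f := fun t => rad - t) b0 D2.
have Dr := is_deriveV (f := fun t => t ^+ 2) r0 D3.
apply: is_derive_eq.
rewrite /hardy_coef' /hardy_coef /GRing.scale/=.
by field; rewrite ?a0 ?b0; lra.
Qed.

(** For a radial field of size [f r = r * hardy_coef r], the left side is [f' + f / r - f^2], that
    is, divergence minus squared length: the Riccati form of the radial equation for [phi]. *)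
Lemma hardy_coef_riccati (R : realType) (rho rad r : R) :
  0 < rho -> rho < r < rad ->
  hardy_coef' rho rad r * r + 2 * hardy_coef rho rad r - (hardy_coef rho rad r * r) ^+ 2 =
  4^-1 * (((r - rho)^-1 + (rad - r)^-1) ^+ 2 - r ^- 2).
Proof.
move=> rho0 /andP[r1 r2]; rewrite /hardy_coef' /hardy_coef.
by field; apply/and3P; split; lra.
Qed.

Lemma modulusE (R : realType) (z : R[i]) :
  modulus z = Num.sqrt (complex.Re z ^+ 2 + complex.Im z ^+ 2).
Proof. by case: z. Qed.

Lemma is_derive_sqrt_sqrD (R : realType) (p q : R -> R) (x p' q' : R) :
  0 < p x ^+ 2 + q x ^+ 2 -> is_derive x 1 p p' -> is_derive x 1 q q' ->
  is_derive x 1 (fun t => Num.sqrt (p t ^+ 2 + q t ^+ 2))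
    ((p x * p' + q x * q') / Num.sqrt (p x ^+ 2 + q x ^+ 2)).
Proof.
move=> r0 Dp Dq.
have Dr : is_derive x 1 (fun t => p t ^+ 2 + q t ^+ 2) (2 * (p x * p' + q x * q')).
  by apply: is_derive_eq; rewrite /GRing.scale/=; ring.
rewrite (_ : _ / _ = (2 * Num.sqrt (p x ^+ 2 + q x ^+ 2))^-1 *
    (2 * (p x * p' + q x * q'))).
  exact: (is_derive1_comp (g := fun t => p t ^+ 2 + q t ^+ 2) (is_derive1_sqrt r0) Dr).
by field; rewrite lt0r_neq0// sqrtr_gt0.
Qed.

(** * The field pulled back by an analytic function *)

Section hardy_field.
Variables (R : realType) (rho rad : R) (Om : set (R * R)).
Variables p q p1 q1 p2 q2 : R * R -> R.

Let r (z : R * R) := Num.sqrt (p z ^+ 2 + q z ^+ 2).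

(* For [F = p + i q] with [F' = p1 + i q1], [A - i B = conj(F) F'], so that
   [grad |F| = (A, B) / |F|]. *)
Let A z := p1 z * p z + q1 z * q z.
Let B z := p1 z * q z - q1 z * p z.

(* The field is [- grad (log phi)] for
   [phi = |F|^(-1/2) ((|F| - rho) (rad - |F|))^(1/2)]. *)
Definition hardy_field1 z := hardy_coef rho rad (r z) * A z.
Definition hardy_field2 z := hardy_coef rho rad (r z) * B z.

(** Here [p2 + i q2] stands for [F'']. Its terms have opposite signs in the two partial derivatives
    and cancel in the divergence, just as the Laplacian of [|F|^2] is [4 |F'|^2]. *)
Definition hardy_field1' z :=
  hardy_coef' rho rad (r z) * (A z / r z) * A z +
  hardy_coef rho rad (r z) *
    (p2 z * p z + p1 z ^+ 2 + q2 z * q z + q1 z ^+ 2).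
Definition hardy_field2' z :=
  hardy_coef' rho rad (r z) * (B z / r z) * B z +
  hardy_coef rho rad (r z) *
    (p1 z ^+ 2 + q1 z ^+ 2 - p2 z * p z - q2 z * q z).

Hypothesis rho0 : 0 < rho.
Hypothesis ann : forall z, Om z -> rho < r z < rad.
Hypotheses
  (px : forall x y, Om (x, y) -> is_derive x 1 (fun t => p (t, y)) (p1 (x, y)))
  (py : forall x y, Om (x, y) -> is_derive y 1 (fun t => p (x, t)) (- q1 (x, y)))
  (qx : forall x y, Om (x, y) -> is_derive x 1 (fun t => q (t, y)) (q1 (x, y)))
  (qy : forall x y, Om (x, y) -> is_derive y 1 (fun t => q (x, t)) (p1 (x, y)))
  (p1x : forall x y, Om (x, y) -> is_derive x 1 (fun t => p1 (t, y)) (p2 (x, y)))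
  (p1y : forall x y, Om (x, y) -> is_derive y 1 (fun t => p1 (x, t)) (- q2 (x, y)))
  (q1x : forall x y, Om (x, y) -> is_derive x 1 (fun t => q1 (t, y)) (q2 (x, y)))
  (q1y : forall x y, Om (x, y) -> is_derive y 1 (fun t => q1 (x, t)) (p2 (x, y)))
  (cp : forall z, Om z -> {for z, continuous p})
  (cq : forall z, Om z -> {for z, continuous q})
  (cp1 : forall z, Om z -> {for z, continuous p1})
  (cq1 : forall z, Om z -> {for z, continuous q1})
  (cp2 : forall z, Om z -> {for z, continuous p2})
  (cq2 : forall z, Om z -> {for z, continuous q2}).

Let sqr_r z : r z ^+ 2 = p z ^+ 2 + q z ^+ 2.
Proof. by rewrite sqr_sqrtr// addr_ge0// sqr_ge0. Qed.

Let r_gt0 z : Om z -> 0 < r z.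
Proof. by move=> /ann/andP[+ _]; exact: lt_trans. Qed.

Let sqr_r_gt0 z : Om z -> 0 < p z ^+ 2 + q z ^+ 2.
Proof. by move=> /r_gt0 r0; rewrite -sqr_r exprn_gt0. Qed.

Lemma is_derive_hardy_field1 (x y : R) : Om (x, y) ->
  is_derive x 1 (fun t => hardy_field1 (t, y)) (hardy_field1' (x, y)).
Proof.
move=> Omxy.
have Dp := px Omxy; have Dq := qx Omxy.
have Dp1 := p1x Omxy; have Dq1 := q1x Omxy.
have Dr : is_derive x 1 (fun t => r (t, y)) (A (x, y) / r (x, y)).
  rewrite (_ : A _ = p (x, y) * p1 (x, y) + q (x, y) * q1 (x, y)).
    exact: (is_derive_sqrt_sqrD (sqr_r_gt0 Omxy) Dp Dq).
  by rewrite /A; ring.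
have Dk : is_derive x 1 (fun t => hardy_coef rho rad (r (t, y))) _ :=
  is_derive1_comp (g := fun t => r (t, y)) (is_derive_hardy_coef rho0 (ann Omxy)) Dr.
rewrite /hardy_field1 /A; apply: is_derive_eq.
by rewrite /GRing.scale/= /hardy_field1' /A; ring.
Qed.

Lemma is_derive_hardy_field2 (x y : R) : Om (x, y) ->
  is_derive y 1 (fun t => hardy_field2 (x, t)) (hardy_field2' (x, y)).
Proof.
move=> Omxy.
have Dp := py Omxy; have Dq := qy Omxy.
have Dp1 := p1y Omxy; have Dq1 := q1y Omxy.
have Dr : is_derive y 1 (fun t => r (x, t)) (B (x, y) / r (x, y)).
  rewrite (_ : B _ = p (x, y) * (- q1 (x, y)) + q (x, y) * p1 (x, y)).
    exact: (is_derive_sqrt_sqrD (sqr_r_gt0 Omxy) Dp Dq).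
  by rewrite /B; ring.
have Dk : is_derive y 1 (fun t => hardy_coef rho rad (r (x, t))) _ :=
  is_derive1_comp (g := fun t => r (x, t)) (is_derive_hardy_coef rho0 (ann Omxy)) Dr.
rewrite /hardy_field2 /B; apply: is_derive_eq.
by rewrite /GRing.scale/= /hardy_field2' /B; ring.
Qed.

(** The vector [(A, B)] is the gradient of [|F|^2 / 2]: its squared length is [|F|^2 |F'|^2] and its
    divergence [2 |F'|^2]. So [|F'|^2] factors out and the radial Riccati expression remains. *)
Lemma hardy_field_div z : Om z ->
  hardy_field1' z + hardy_field2' z - hardy_field1 z ^+ 2 - hardy_field2 z ^+ 2 =
  (p1 z ^+ 2 + q1 z ^+ 2) *
    (4^-1 * (((r z - rho)^-1 + (rad - r z)^-1) ^+ 2 - r z ^- 2)).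
Proof.
move=> Omz; have r0 := r_gt0 Omz.
rewrite -(hardy_coef_riccati rho0 (ann Omz)).
have AB : A z ^+ 2 + B z ^+ 2 = (p1 z ^+ 2 + q1 z ^+ 2) * r z ^+ 2.
  by rewrite sqr_r /A /B; ring.
transitivity (hardy_coef' rho rad (r z) / r z * (A z ^+ 2 + B z ^+ 2) +
    2 * hardy_coef rho rad (r z) * (p1 z ^+ 2 + q1 z ^+ 2) -
    hardy_coef rho rad (r z) ^+ 2 * (A z ^+ 2 + B z ^+ 2)).
  by rewrite /hardy_field1' /hardy_field2' /hardy_field1 /hardy_field2; ring.
by rewrite AB; field; rewrite lt0r_neq0.
Qed.

Let cr z : Om z -> {for z, continuous r}.
Proof.
move=> Omz; apply: (@continuous_comp _ _ _ (fun z => p z ^+ 2 + q z ^+ 2) Num.sqrt).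
  by apply: cvgD; apply: cvgM; by [exact: cp|exact: cq].
exact: sqrt_continuous.
Qed.

Let cA z : Om z -> {for z, continuous A}.
Proof.
by move=> Omz; apply: cvgD; apply: cvgM; by [exact: cp|exact: cq|exact: cp1|exact: cq1].
Qed.

Let cB z : Om z -> {for z, continuous B}.
Proof.
by move=> Omz; apply: cvgB; apply: cvgM; by [exact: cp|exact: cq|exact: cp1|exact: cq1].
Qed.

Let ccoef z : Om z -> {for z, continuous (fun z => hardy_coef rho rad (r z))}.
Proof.
move=> Omz; apply: continuous_comp; first exact: cr.
apply: differentiable_continuous; apply/derivable1_diffP.
by case: (is_derive_hardy_coef rho0 (ann Omz)).
Qed.

Let ccoef' z : Om z -> {for z, continuous (fun z => hardy_coef' rho rad (r z))}.
Proof.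
move=> Omz; have /andP[r1 r2] := ann Omz; have r0 := r_gt0 Omz.
have cV (f : R * R -> R) : f z != 0 -> {for z, continuous f} ->
    {for z, continuous (fun z => (f z)^-1)}.
  by move=> f0 cf; apply: cvgV.
have ca : {for z, continuous (fun z => (r z - rho)^-1)}.
  by apply: cV; [rewrite subr_eq0 gt_eqF|apply: cvgB; [exact: cr|exact: cvg_cst]].
have cb : {for z, continuous (fun z => (rad - r z)^-1)}.
  by apply: cV; [rewrite subr_eq0 gt_eqF|apply: cvgB; [exact: cvg_cst|exact: cr]].
have ci : {for z, continuous (fun z => (r z)^-1)}.
  by apply: (cV r); [rewrite gt_eqF|exact: cr].
(* Negative powers become products of inverses, so that closure of continuity under sums, opposites
   and products suffices. *)
rewrite (_ : (fun z => _) = fun z =>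
   (- (2^-1 * (r z - rho)^-1) + r z * 2^-1 * ((r z - rho)^-1 * (r z - rho)^-1)
   + 2^-1 * (rad - r z)^-1 + r z * 2^-1 * ((rad - r z)^-1 * (rad - r z)^-1)) *
   ((r z)^-1 * (r z)^-1) - 2 * hardy_coef rho rad (r z) * (r z)^-1); last first.
  by apply/funext => w; rewrite /hardy_coef' -!expr2 !exprVn.
have cc w : {for z, continuous (fun _ : R * R => w : R)} by exact: cvg_cst.
have ch := ccoef Omz.
have cM (f g : R * R -> R) : {for z, continuous f} -> {for z, continuous g} ->
  {for z, continuous (fun z => f z * g z)} by exact: cvgM.
have cD (f g : R * R -> R) : {for z, continuous f} -> {for z, continuous g} ->
  {for z, continuous (fun z => f z + g z)} by exact: cvgD.
have cN (f : R * R -> R) : {for z, continuous f} ->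
  {for z, continuous (fun z => - f z)} by exact: cvgN.
have h2 := cM _ _ (cr Omz) (cc 2^-1).
have h3 := cD _ _ (cN _ (cM _ _ (cc 2^-1) ca)) (cM _ _ h2 (cM _ _ ca ca)).
have h4 := cD _ _ (cD _ _ h3 (cM _ _ (cc 2^-1) cb)) (cM _ _ h2 (cM _ _ cb cb)).
exact: (cD _ _ (cM _ _ h4 (cM _ _ ci ci)) (cN _ (cM _ _ (cM _ _ (cc 2) ch) ci))).
Qed.

Lemma continuous_hardy_field1 z : Om z -> {for z, continuous hardy_field1}.
Proof. by move=> Omz; apply: cvgM; [exact: ccoef|exact: cA]. Qed.

Lemma continuous_hardy_field2 z : Om z -> {for z, continuous hardy_field2}.
Proof. by move=> Omz; apply: cvgM; [exact: ccoef|exact: cB]. Qed.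

Let cdiv (f : R * R -> R) z : Om z -> {for z, continuous f} ->
  {for z, continuous (fun z => f z / r z)}.
Proof.
move=> Omz cf; apply: cvgM => //; apply: cvgV; last exact: cr.
by rewrite gt_eqF// r_gt0.
Qed.

Lemma continuous_hardy_field1' z : Om z -> {for z, continuous hardy_field1'}.
Proof.
move=> Omz; apply: cvgD; apply: cvgM.
- by apply: cvgM; [exact: ccoef'|apply: cdiv => //; exact: cA].
- exact: cA.
- exact: ccoef.
- apply: cvgD; last by apply: cvgM; exact: cq1.
  apply: cvgD; last by apply: cvgM; [exact: cq2|exact: cq].
  apply: cvgD; last by apply: cvgM; exact: cp1.
  by apply: cvgM; [exact: cp2|exact: cp].
Qed.

Lemma continuous_hardy_field2' z : Om z -> {for z, continuous hardy_field2'}.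
Proof.
move=> Omz; apply: cvgD; apply: cvgM.
- by apply: cvgM; [exact: ccoef'|apply: cdiv => //; exact: cB].
- exact: cB.
- exact: ccoef.
- apply: cvgB; last by apply: cvgM; [exact: cq2|exact: cq].
  apply: cvgB; last by apply: cvgM; [exact: cp2|exact: cp].
  by apply: cvgD; apply: cvgM; by [exact: cp1|exact: cq1].
Qed.

End hardy_field.

(** * The inequality for the weight of the conformal map *)

Theorem theorem7 (R : realType) (Om1 Om2 : set (R * R)) (rho rad : R)
    (F : R[i] -> R[i]) :
  let Om := Om2 `\` closure Om1 in
  Om1 `<=` Om2 ->
  domain Om -> doubly_connected Om ->
  0 < rho < rad ->
  analytic_on (@toC R @` Om) F ->
  set_inj (@toC R @` Om) F ->
  F @` (@toC R @` Om) = annulus rho rad ->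
  forall u : R * R -> R[i], test_function Om u ->
  (\int[@lebesgue2 R]_(x in Om) (grad_sq u x)%:E >=
   (4^-1)%:E *
     \int[@lebesgue2 R]_(x in Om)
       (hardy_weight rho rad F x * modulus (u x) ^+ 2)%:E)%E.
Proof.
move=> Om _ _ _ /andP[rho0 _] anF _ FOm u [uC vC cK KOm].
have annF z : Om z -> rho < modulus (F (toC z)) < rad.
  move=> Omz; suff : annulus rho rad (F (toC z)) by [].
  by rewrite -FOm; exists (toC z) => //; exists z.
have u0 z : ~ closure [set x | u x != 0] z -> u z = 0.
  by move=> nKz; apply/eqP/negPn/negP => /(@subset_closure _ [set x | u x != 0] z).
pose p (z : R * R) := complex.Re (F (toC z)).
pose q (z : R * R) := complex.Im (F (toC z)).
pose p1 (z : R * R) := complex.Re (cderiv F (toC z)).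
pose q1 (z : R * R) := complex.Im (cderiv F (toC z)).
pose p2 (z : R * R) := complex.Re (cderiv (cderiv F) (toC z)).
pose q2 (z : R * R) := complex.Im (cderiv (cderiv F) (toC z)).
have anF1 := analytic_on_cderiv anF; have anF2 := analytic_on_cderiv anF1.
have toCOm z : Om z -> (@toC R @` Om) (toC z) by exists z.
have dF x y : Om (x, y) -> quad_diff F (cderiv F (x +i* y)) (x +i* y).
  by move=> /toCOm; exact: analytic_on_quad_diff.
have dF1 x y : Om (x, y) ->
    quad_diff (cderiv F) (cderiv (cderiv F) (x +i* y)) (x +i* y).
  by move=> /toCOm; exact: analytic_on_quad_diff.
(* The third derivative serves only to make [F''], hence the derivatives of the field,
   continuous. *)
have dF2 x y : Om (x, y) -> quad_diff (cderiv (cderiv F))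
    (cderiv (cderiv (cderiv F)) (x +i* y)) (x +i* y).
  by move=> /toCOm; exact: analytic_on_quad_diff.
have px x y : Om (x, y) -> is_derive x 1 (fun t => p (t, y)) (p1 (x, y)).
  by move=> /dF; exact: is_derive_Re_x.
have py x y : Om (x, y) -> is_derive y 1 (fun t => p (x, t)) (- q1 (x, y)).
  by move=> /dF; exact: is_derive_Re_y.
have qx x y : Om (x, y) -> is_derive x 1 (fun t => q (t, y)) (q1 (x, y)).
  by move=> /dF; exact: is_derive_Im_x.
have qy x y : Om (x, y) -> is_derive y 1 (fun t => q (x, t)) (p1 (x, y)).
  by move=> /dF; exact: is_derive_Im_y.
have p1x x y : Om (x, y) -> is_derive x 1 (fun t => p1 (t, y)) (p2 (x, y)).
  by move=> /dF1; exact: is_derive_Re_x.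
have p1y x y : Om (x, y) -> is_derive y 1 (fun t => p1 (x, t)) (- q2 (x, y)).
  by move=> /dF1; exact: is_derive_Re_y.
have q1x x y : Om (x, y) -> is_derive x 1 (fun t => q1 (t, y)) (q2 (x, y)).
  by move=> /dF1; exact: is_derive_Im_x.
have q1y x y : Om (x, y) -> is_derive y 1 (fun t => q1 (x, t)) (p2 (x, y)).
  by move=> /dF1; exact: is_derive_Im_y.
have cp z : Om z -> {for z, continuous p}.
  by case: z => x y /dF; exact: continuous_Re_toC.
have cq z : Om z -> {for z, continuous q}.
  by case: z => x y /dF; exact: continuous_Im_toC.
have cp1 z : Om z -> {for z, continuous p1}.
  by case: z => x y /dF1; exact: continuous_Re_toC.
have cq1 z : Om z -> {for z, continuous q1}.
  by case: z => x y /dF1; exact: continuous_Im_toC.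
have cp2 z : Om z -> {for z, continuous p2}.
  by case: z => x y /dF2; exact: continuous_Re_toC.
have cq2 z : Om z -> {for z, continuous q2}.
  by case: z => x y /dF2; exact: continuous_Im_toC.
have ann z : Om z -> rho < Num.sqrt (p z ^+ 2 + q z ^+ 2) < rad.
  by move=> /annF; rewrite modulusE.
have := @hardy_from_vector_field R Om _ cK KOm
  (fun x => complex.Re (u x)) (fun x => complex.Im (u x))
  (hardy_field1 rho rad p q p1 q1) (hardy_field2 rho rad p q p1 q1)
  (hardy_field1' rho rad p q p1 q1 p2 q2) (hardy_field2' rho rad p q p1 q1 p2 q2)
  (hardy_weight rho rad F) 4^-1 (uC 1) (vC 1).
(* [grad_sq] groups the squares by direction of differentiation, the general inequality by real and
   imaginary part of [u]. *)
have -> : (fun x => (grad_sq u x)%:E) = (fun x =>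
   (d1 (fun x => complex.Re (u x)) x ^+ 2 + d2 (fun x => complex.Re (u x)) x ^+ 2 +
   (d1 (fun x => complex.Im (u x)) x ^+ 2 + d2 (fun x => complex.Im (u x)) x ^+ 2))%:E).
  by apply/funext => x; rewrite /grad_sq !sqr_modulus/= addrACA.
under [in X in _ -> (_ * X <= _)%E]eq_fun do rewrite sqr_modulus.
apply.
- by move=> z /u0 ->.
- by move=> z /u0 ->.
- exact: (is_derive_hardy_field1 rho0 ann px qx p1x q1x).
- exact: (is_derive_hardy_field2 rho0 ann py qy p1y q1y).
- exact: (continuous_hardy_field1 rho0 ann cp cq cp1 cq1).
- exact: (continuous_hardy_field2 rho0 ann cp cq cp1 cq1).
- exact: (continuous_hardy_field1' rho0 ann cp cq cp1 cq1 cp2 cq2).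
- exact: (continuous_hardy_field2' rho0 ann cp cq cp1 cq1 cp2 cq2).
- by rewrite invr_gt0.
- move=> z Omz; rewrite (hardy_field_div p1 q1 p2 q2 rho0 ann Omz).
  rewrite /hardy_weight !modulusE -/(p z) -/(q z).
  rewrite [Num.sqrt (complex.Re (cderiv F _) ^+ 2 + _) ^+ 2]sqr_sqrtr; last first.
    by rewrite addr_ge0// sqr_ge0.
  by rewrite -/(p1 z) -/(q1 z); ring.
Qed.
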